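(* Suppose that for every integer $g\ge 1$ and every integer $\gamma$ with $\lfloor g/3\rfloor+1\le\gamma\le\lfloor 2g/3\rfloor$ one has $N_\gamma(g+1)>N_\gamma(g)$. Then $n_{g+1}>n_g$ for every integer $g\ge 1$.
   Context: A numerical semigroup $S$ is a submonoid of $(\mathbb{N}_0,+)$ ($\mathbb{N}_0$ the nonnegative integers) whose set of gaps $\mathbb{N}_0\setminus S$ is finite; its genus is the number of its gaps. $n_g$ is the number of numerical semigroups of genus $g$, and $N_\gamma(g)$ is the number of numerical semigroups of genus $g$ having exactly $\gamma$ even gaps. *)

(* Defs.v *)
From mathcomp Require Import all_boot finmap.
From mathcomp Require Import boolp classical_sets functions cardinality.

Set Implicit Arguments.
Unset Strict Implicit.
Unset Printing Implicit Defensive.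

Local Open Scope nat_scope.
Local Open Scope classical_set_scope.

Definition gaps (S : set nat) : set nat := ~` S.

Definition even_gaps (S : set nat) : set nat := gaps S `&` [set x | ~~ odd x].

Definition numerical_semigroup (S : set nat) : Prop :=
  [/\ S 0,
      forall a b, S a -> S b -> S (a + b)%N
    & finite_set (gaps S)].

Definition genus (S : set nat) : nat := #|` fset_set (gaps S)|.

Definition semigroups_of_genus (g : nat) : set (set nat) :=
  [set S | numerical_semigroup S /\ genus S = g].

Definition semigroups_with_even_gaps (gamma g : nat) : set (set nat) :=
  [set S | semigroups_of_genus g S /\ #|` fset_set (even_gaps S)| = gamma].

(* [fset_set A] is [fset0] when [A] is infinite; the finiteness lemmas below
   show that this default is never used in [n_] and [N_]. *)
Definition n_ (g : nat) : nat := #|` fset_set (semigroups_of_genus g)|.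

Definition N_ (gamma g : nat) : nat :=
  #|` fset_set (semigroups_with_even_gaps gamma g)|.

Lemma gap_lt_double_genus (S : set nat) (x : nat) :
  numerical_semigroup S -> gaps S x -> (x < (genus S).*2)%N.
Proof.
move=> [S0 SD fS] Gx; rewrite /genus; set G := fset_set _.
pose I := seq_fset tt (iota 0 x.+1).
have cI : #|` I| = x.+1 by rewrite size_seq_fset undup_id ?iota_uniq ?size_iota.
have sub : (I `<=` G `|` [fset (x - y)%N | y in G])%fset.
  apply/fsubsetP => y; rewrite seq_fsetE mem_iota add0n ltnS => /andP[_ yx].
  rewrite inE; apply/orP.
  have [Sy|Gy] := pselect (S y); last by left; rewrite in_fset_set// inE.
  right; apply/imfsetP; exists (x - y)%N; last by rewrite subKn.
  rewrite /= in_fset_set// inE => Sxy; apply: Gx.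
  by rewrite -(subnKC yx); exact: SD.
rewrite -cI -addnn; apply: leq_trans (fsubset_leq_card sub) _.
rewrite cardfsU; apply: leq_trans (leq_subr _ _) _.
by rewrite leq_add2l leq_imfset_card.
Qed.

Lemma finite_semigroups_of_genus (g : nat) :
  finite_set (semigroups_of_genus g).
Proof.
pose I := seq_fset tt (iota 0 g.*2).
apply: (@sub_finite_set _ _
  ((fun X : {fset nat} => ~` [set` X]) @` [set` fpowerset I])); last first.
  exact: finite_image.
move=> S [nS gS]; have [_ _ fS] := nS; exists (fset_set (gaps S)) => /=.
  rewrite fpowersetE; apply/fsubsetP => y; rewrite in_fset_set// inE => Gy.
  by rewrite seq_fsetE mem_iota add0n -gS gap_lt_double_genus.
by rewrite fset_setK// setCK.
Qed.

Lemma finite_semigroups_with_even_gaps (gamma g : nat) :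
  finite_set (semigroups_with_even_gaps gamma g).
Proof.
by apply: sub_finite_set (finite_semigroups_of_genus g) => S [].
Qed.

(* Main.v *)
Require Import Defs.
From mathcomp Require Import all_boot.
From mathcomp Require Import finmap.
From mathcomp Require Import boolp classical_sets cardinality.
From mathcomp Require Import zify.

Set Implicit Arguments.
Unset Strict Implicit.
Unset Printing Implicit Defensive.

(** Sort the semigroups of genus g by their number c of even gaps, so that
    n_g is the sum of N_c(g), and compare the sums for g and g + 1 term by term.

    If c <= g / 3, the term does not decrease: moving all odd elements of a
    semigroup S up by 2 and keeping the even ones ([shift_odd]) adds exactly one
    gap, which is odd, and S can be recovered from the result. The result is
    closed under addition for the following reason. A sum of an even and an odd
    element causes no trouble, and the sum of two shifted odd elements a + 2 and
    b + 2 is even, so it only has to be large. If a is an odd element of S, an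
    odd gap is below a or is a plus an even gap; there are at least 2c odd gaps
    and c even ones, so at least c odd numbers are below a, that is a > 2c
    ([odd_gaps_le_odd_element]). On the other hand the half of the even part of
    S is a numerical semigroup of genus c, whose gaps are below 2c, so every even
    number from 4c on lies in S ([even_ge_in]).

    If g / 3 < c <= 2g / 3, the term increases by hypothesis.

    If c > 2g / 3, then N_c(g) = 0: some even gap is at least 2c, and out of two
    odd numbers that add up to it at least one is a gap, so there are at least
    c / 2 odd gaps ([even_gaps_le_double_odd_gaps]).

    Some term increases strictly: the middle range is nonempty when g >= 2, and
    for g = 1 the semigroup with gaps 1 and 2 gives N_1(2) > 0 = N_1(1). *)

Local Open Scope nat_scope.
Local Open Scope classical_set_scope.

(** * Even and odd gaps *)

Definition odd_gaps (S : set nat) : set nat := gaps S `&` [set x | odd x].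

Definition n_even (S : set nat) : nat := #|` fset_set (even_gaps S)|.
Definition n_odd (S : set nat) : nat := #|` fset_set (odd_gaps S)|.

Lemma finite_even_gaps S : numerical_semigroup S -> finite_set (even_gaps S).
Proof. by case=> _ _ fS; apply: sub_finite_set fS => x []. Qed.

Lemma finite_odd_gaps S : numerical_semigroup S -> finite_set (odd_gaps S).
Proof. by case=> _ _ fS; apply: sub_finite_set fS => x []. Qed.

Lemma gaps_even_odd S : gaps S = even_gaps S `|` odd_gaps S.
Proof.
apply/seteqP; split=> x /=; last by case=> -[].
by move=> Gx; case: (boolP (odd x)) => ox; [right|left].
Qed.

Lemma genus_even_odd S :
  numerical_semigroup S -> genus S = n_even S + n_odd S.
Proof.
move=> nS; have fE := finite_even_gaps nS; have fO := finite_odd_gaps nS.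
rewrite /genus gaps_even_odd fset_setU//; apply/eqP.
rewrite cardfsU -fset_setI// (_ : even_gaps S `&` odd_gaps S = set0).
  by rewrite fset_set0 cardfs0 subn0.
by apply/seteqP; split=> x //= [[_ /= /negP ?] [_ /= ?]].
Qed.

Lemma card_fset_set_image (f : nat -> nat) (A : set nat) :
  injective f -> finite_set A -> #|` fset_set (f @` A)| = #|` fset_set A|.
Proof. by move=> fI fA; rewrite fset_set_image// card_imfset. Qed.

(** The form in which counting arguments are used here: an explicit list of
    candidates bounds the size of a finite set. *)
Lemma card_fset_set_le_size (A : set nat) (s : seq nat) :
  finite_set A -> (forall x, A x -> x \in s) -> #|` fset_set A| <= size s.
Proof.
move=> fA As; apply: uniq_leq_size; first exact: fset_uniq.
by move=> x; rewrite in_fset_set// inE => /As.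
Qed.

(** * The number of even gaps is at most twice the number of odd gaps *)

(** By counting: the even gaps are nonzero, and there are only c - 1 nonzero
    even numbers below 2c. *)
Lemma exists_large_even_gap S :
  numerical_semigroup S -> 0 < n_even S ->
  exists2 x, n_even S <= x & gaps S x.*2.
Proof.
move=> nS cpos; apply: contrapT => noS.
suff : n_even S <= (n_even S).-1 by lia.
rewrite -[X in _ <= X](size_iota 1) -(size_map double).
apply: card_fset_set_le_size; first exact: finite_even_gaps.
move=> y [Gy /= ey]; apply/mapP; exists y./2; last by lia.
have yE : y./2.*2 = y by lia.
rewrite mem_iota; have [|y0] := posnP y./2.
  by case: nS => S0 _ _ y0; case: Gy; rewrite -yE y0.
rewrite add1n prednK//= ltnNge; apply/negP => cy; apply: noS.
by exists y./2; rewrite // yE.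
Qed.

Lemma even_gaps_le_double_odd_gaps S :
  numerical_semigroup S -> n_even S <= (n_odd S).*2.
Proof.
move=> nS; have [->//|cpos] := posnP (n_even S).
have [x cx Gx] := exists_large_even_gap nS cpos; apply: leq_trans cx _.
pose O : seq nat := fset_set (odd_gaps S).
(* For y odd below 2x, either y or 2x - y is an odd gap. *)
rewrite -addnn -[X in X + _](size_map id O) -[X in _ + X](size_map (subn x.*2) O).
rewrite -size_cat -[X in X <= _](size_iota 0) -(size_map (fun i => i.*2.+1)).
have memO y : odd y -> ~ S y -> y \in O.
  by move=> oy Sy; rewrite in_fset_set ?inE//; exact: finite_odd_gaps.
apply: uniq_leq_size; first by rewrite map_inj_uniq ?iota_uniq// => i j; lia.
move=> y /mapP[i]; rewrite mem_iota => /andP[_ ix] yE.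
rewrite mem_cat; have [Sy|Sy] := pselect (S y); last first.
  by rewrite map_id memO//; lia.
apply/orP; right; apply/mapP; exists (x.*2 - y); last by lia.
apply: memO; first by lia.
move=> Sxy; apply: Gx; have -> : x.*2 = y + (x.*2 - y) by lia.
by case: nS => _ SD _; exact: SD.
Qed.

(** * Semigroups with few even gaps *)

Definition half_semigroup (S : set nat) : set nat := [set x | S x.*2].

Lemma gaps_half_semigroup S : double @` gaps (half_semigroup S) = even_gaps S.
Proof.
apply/seteqP; split=> [_ [x Gx <-]|x [Gx /= ex]].
  by split=> //=; rewrite odd_double.
have xE : x./2.*2 = x by lia.
by exists x./2; rewrite // /gaps /half_semigroup /= xE.
Qed.

Lemma numerical_semigroup_half S :
  numerical_semigroup S -> numerical_semigroup (half_semigroup S).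
Proof.
case=> S0 SD fS; split=> //.
- by move=> a b Sa Sb; rewrite /half_semigroup /= doubleD; exact: SD.
- by apply: (finite_preimage _ fS) => i j _ _; exact: double_inj.
Qed.

Lemma genus_half_semigroup S :
  numerical_semigroup S -> genus (half_semigroup S) = n_even S.
Proof.
move=> /numerical_semigroup_half[_ _ fT].
by rewrite /n_even -gaps_half_semigroup card_fset_set_image//; exact: double_inj.
Qed.

Lemma even_ge_in S x :
  numerical_semigroup S -> ~~ odd x -> 4 * n_even S <= x -> S x.
Proof.
move=> nS ex cx; apply: contrapT => Sx.
have xE : x./2.*2 = x by lia.
have Gx : gaps (half_semigroup S) x./2 by rewrite /gaps /half_semigroup /= xE.
have := gap_lt_double_genus (numerical_semigroup_half nS) Gx.
by rewrite genus_half_semigroup//; lia.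
Qed.

(** An odd gap above a is a plus an even gap. *)
Lemma odd_gaps_le_odd_element S a :
  numerical_semigroup S -> S a -> odd a -> n_odd S <= a./2 + n_even S.
Proof.
move=> nS Sa oa; pose E : seq nat := fset_set (even_gaps S).
rewrite -[X in X + _](size_iota 0) -[X in X + _](size_map (fun i => i.*2.+1)).
rewrite -[X in _ + X](size_map (addn a) E) -size_cat.
apply: card_fset_set_le_size; first exact: finite_odd_gaps.
move=> y [Gy /= oy]; rewrite mem_cat; apply/orP.
have [ya|ay] := ltnP y a.
  by left; apply/mapP; exists y./2; rewrite ?mem_iota; lia.
right; apply/mapP; exists (y - a); last by lia.
rewrite in_fset_set ?inE; last exact: finite_even_gaps.
split=> /=; last by lia.
by move=> Sya; apply: Gy; case: nS => _ SD _; rewrite -(subnKC ay); exact: SD.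
Qed.

(** * Shifting the odd elements *)

Definition shift_odd (S : set nat) : set nat :=
  [set x | if odd x then 2 <= x /\ S (x - 2) else S x].

Lemma shift_odd_even S x : ~~ odd x -> shift_odd S x = S x.
Proof. by rewrite /shift_odd /= => /negbTE ->. Qed.

Lemma shift_odd_odd S x : odd x -> shift_odd S x.+2 = S x.
Proof.
rewrite /shift_odd /= negbK subn2 /= => ->.
by apply/propext; split=> [[]|].
Qed.

Lemma shift_odd_inj : injective shift_odd.
Proof.
move=> S S' eqS; apply/funext => x; case: (boolP (odd x)) => ox.
  by rewrite -(shift_odd_odd S ox) eqS shift_odd_odd.
by rewrite -(shift_odd_even S ox) eqS shift_odd_even.
Qed.

Lemma even_gaps_shift_odd S : even_gaps (shift_odd S) = even_gaps S.
Proof.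
by apply/seteqP; split=> x [Gx /= ex]; split=> //; move: Gx;
  rewrite /gaps /= shift_odd_even.
Qed.

Lemma odd_gaps_shift_odd S :
  odd_gaps (shift_odd S) = 1 |` ((addn 2) @` odd_gaps S).
Proof.
apply/seteqP; split=> x.
  case: x => [|[|x]] [Gx //= ox]; first by left.
  right; exists x => //; split; last by rewrite negbK in ox.
  by move: Gx; rewrite /gaps /= shift_odd_odd// -[odd x]negbK.
case=> [->|[y [Gy /= oy] <-]]; first by split=> //= -[].
by split; rewrite /= ?negbK// /gaps /= shift_odd_odd.
Qed.

Lemma finite_odd_gaps_shift S :
  numerical_semigroup S -> finite_set (odd_gaps (shift_odd S)).
Proof.
move=> nS; rewrite odd_gaps_shift_odd finite_setU; split=> //.
by apply: finite_image; exact: finite_odd_gaps.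
Qed.

Lemma n_odd_shift_odd S :
  numerical_semigroup S -> n_odd (shift_odd S) = (n_odd S).+1.
Proof.
move=> nS; have fO := finite_odd_gaps nS.
have fO2 : finite_set (addn 2 @` odd_gaps S) by exact: finite_image.
rewrite /n_odd odd_gaps_shift_odd fset_setU1// cardfsU1 card_fset_set_image//.
  by rewrite in_fset_set// memNset// => -[].
exact: addnI.
Qed.

Lemma numerical_semigroup_shift_odd S :
  numerical_semigroup S -> (n_even S).*2 <= n_odd S ->
  numerical_semigroup (shift_odd S).
Proof.
move=> nS co; have [S0 SD _] := nS.
(* Two odd elements of the shifted set thus add up to more than 4c, where c is
   the number of even gaps. *)
have odd_large a : odd a -> shift_odd S a -> n_even S + 1 <= a./2.
  rewrite /shift_odd /= => oa; rewrite oa => -[a2 Sa].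
  have oa2 : odd (a - 2) by lia.
  by have := odd_gaps_le_odd_element nS Sa oa2; lia.
split.
- by rewrite shift_odd_even.
- have mixed a b : odd a -> ~~ odd b ->
      shift_odd S a -> shift_odd S b -> shift_odd S (a + b).
    move=> oa eb; rewrite (shift_odd_even S eb) /shift_odd /= oddD oa (negbTE eb).
    move=> [a2 Sa] Sb; split; first by lia.
    by rewrite -addnBAC//; exact: SD.
  move=> a b Sa Sb; case: (boolP (odd a)) => oa; case: (boolP (odd b)) => ob.
  + rewrite shift_odd_even ?oddD ?oa ?ob//; apply: even_ge_in => //.
      by rewrite oddD oa ob.
    by have := odd_large _ oa Sa; have := odd_large _ ob Sb; lia.
  + exact: mixed.
  + by rewrite addnC; exact: mixed.
  + rewrite shift_odd_even ?oddD ?(negbTE oa) ?(negbTE ob)//.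
    by apply: SD; rewrite -shift_odd_even.
- rewrite gaps_even_odd finite_setU even_gaps_shift_odd.
  by split; [exact: finite_even_gaps|exact: finite_odd_gaps_shift].
Qed.

(** From g >= 3c on there are at least 2c odd gaps, which is what makes the
    shifted set a semigroup. *)
Lemma N_le_succ c g : 3 * c <= g -> N_ c g <= N_ c g.+1.
Proof.
move=> cg; have fA := finite_semigroups_with_even_gaps c g.
have fA1 := finite_semigroups_with_even_gaps c g.+1.
rewrite /N_; set A := fset_set _.
have <- : #|` (shift_odd @` A)%fset| = #|` A|.
  by rewrite card_imfset//; exact: shift_odd_inj.
apply: fsubset_leq_card; rewrite {}/A; apply/fsubsetP => _ /imfsetP[S /= + ->].
rewrite !in_fset_set// !inE => -[[nS gS] cS].
have genusE := genus_even_odd nS; rewrite /n_even cS gS in genusE.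
have nS' : numerical_semigroup (shift_odd S).
  by apply: numerical_semigroup_shift_odd; rewrite // /n_even cS; lia.
split; last by rewrite even_gaps_shift_odd.
split=> //; rewrite genus_even_odd// n_odd_shift_odd// /n_even.
by rewrite even_gaps_shift_odd cS; lia.
Qed.

(** * Summing over the number of even gaps *)

Lemma N_eq0 c g : 2 * g < 3 * c -> N_ c g = 0.
Proof.
move=> gc; rewrite /N_ [X in fset_set X](_ : _ = set0) ?fset_set0 ?cardfs0//.
apply/seteqP; split=> // S [[nS gS] cS].
have := even_gaps_le_double_odd_gaps nS; have := genus_even_odd nS.
by rewrite gS /n_even cS; lia.
Qed.

Lemma N_card_filter c g :
  N_ c g = count (fun S => n_even S == c) (fset_set (semigroups_of_genus g)).
Proof.
have fA := finite_semigroups_of_genus g.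
rewrite -size_filter; apply/perm_size/uniq_perm.
- exact: fset_uniq.
- by apply: filter_uniq; exact: fset_uniq.
- move=> S; rewrite mem_filter !in_fset_set//; last first.
    exact: finite_semigroups_with_even_gaps.
  apply/idP/idP; first by rewrite !inE => -[? /eqP ?]; apply/andP; rewrite inE.
  by rewrite inE => /andP[/eqP ?]; rewrite inE.
Qed.

(** A semigroup of genus g has at most g even gaps. The bound m is left free so
    that n_g and n_(g+1) become sums over the same range. *)
Lemma n_sum_N m g : g < m -> n_ g = \sum_(c < m) N_ c g.
Proof.
move=> gm; under eq_bigr => c _ do rewrite N_card_filter -sum1_count.
under eq_bigr => c _ do rewrite big_mkcond.
rewrite exchange_big /= /n_ card_fset_sum1.
rewrite big_seq [RHS]big_seq; apply: eq_bigr => S.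
rewrite in_fset_set ?inE; last exact: finite_semigroups_of_genus.
move=> [nS gS]; have cm : n_even S < m by have := genus_even_odd nS; lia.
rewrite (bigD1 (Ordinal cm)) //= eqxx big1 ?addn0// => i /negbTE neq.
by rewrite eq_sym -val_eqE /= in neq; rewrite neq.
Qed.

(** The semigroup with gaps 1 and 2 is counted here. *)
Lemma N_1_2_gt0 : 0 < N_ 1 2.
Proof.
pose S : set nat := [set x | x = 0 \/ 3 <= x].
have evenE : even_gaps S = [set 2].
  apply/seteqP; split=> x; rewrite /even_gaps /gaps /S /=.
    by case=> Gx ex; lia.
  by move=> ->; split=> // -[].
have oddE : odd_gaps S = [set 1].
  apply/seteqP; split=> x; rewrite /odd_gaps /gaps /S /=.
    by case=> Gx ox; lia.
  by move=> ->; split=> // -[].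
have nS : numerical_semigroup S.
  split; first by left.
  - by rewrite /S /= => a b Sa Sb; lia.
  - by rewrite gaps_even_odd evenE oddE finite_setU.
have cS : n_even S = 1 by rewrite /n_even evenE fset_set1 cardfs1.
rewrite /N_ cardfs_gt0; apply/fset0Pn; exists S.
rewrite in_fset_set ?inE; last exact: finite_semigroups_with_even_gaps.
split=> //; split=> //.
by rewrite genus_even_odd// cS /n_odd oddE fset_set1 cardfs1.
Qed.

Theorem mainTheorem3 :
  (forall g gamma : nat,
     (1 <= g)%N ->
     (g %/ 3 + 1 <= gamma)%N -> (gamma <= (2 * g) %/ 3)%N ->
     (N_ gamma (g + 1) > N_ gamma g)%N) ->
  forall g : nat, (1 <= g)%N -> (n_ (g + 1) > n_ g)%N.
Proof.
move=> hyp g g1.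
have N_le c : N_ c g <= N_ c (g + 1).
  have [cg|cg] := leqP (3 * c) g; first by rewrite addn1; exact: N_le_succ.
  have [gc|gc] := ltnP (2 * g) (3 * c); first by rewrite N_eq0.
  by apply/ltnW/hyp => //; lia.
have c_lt : g %/ 3 + 1 < g + 2 by lia.
have N_lt : N_ (g %/ 3 + 1) g < N_ (g %/ 3 + 1) (g + 1).
  have [->|g2] : g = 1 \/ 2 <= g by lia.
    by rewrite N_eq0//; exact: N_1_2_gt0.
  by apply: hyp => //; lia.
rewrite (@n_sum_N (g + 2) g) ?(@n_sum_N (g + 2) (g + 1)); try lia.
rewrite (bigD1 (Ordinal c_lt)) //= [X in _ < X](bigD1 (Ordinal c_lt)) //=.
by rewrite -addSn leq_add// leq_sum.
Qed.
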